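(* Let $m_0$ and $m$ be natural numbers with $m\ge m_0$, and let $f\in C^{2m-}$. Suppose that: (a) $f^{(2m_0-1)}(x)\to0$ as $x\to\infty$; (b) the series $\sum_{k=0}^\infty f^{(2m)}(k+w)$ converges uniformly in $w\in[-m/2,m/2]$; (c) $f^{(2j-1)}(x)\to0$ as $x\to\infty$ for $j=m_0,\dots,m-1$; (d) $\int_0^\infty|f^{(2m-1)}(x)|\,dx<\infty$. Let $F$ be any antiderivative of $f$. Then $$G_{m_0,F}(n)-G^{\mathrm{EM}}_{m_0,F}(n)\to0\quad\text{as }n\to\infty,$$ and hence $$\sum_{k\ge0}^{\mathrm{Alt}}f(k)=\sum_{k\ge0}^{\mathrm{EM}}f(k).$$ Moreover, $G_{m,P}(n)=G^{\mathrm{EM}}_{m,P}(n)$ for any polynomial $P$ of degree $\le2m_0-1$ and any nonnegative integer $n$.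
   Context: For a natural number $\alpha$, $C^{\alpha-}$ denotes the set of all functions $f:\mathbb R\to\mathbb R$ having continuous derivatives $f^{(i)}$ of all orders $i=0,\dots,\alpha-1$ and such that $f^{(\alpha-1)}$ is absolutely continuous, with a Radon–Nikodym derivative denoted by $f^{(\alpha)}$. For natural $m$ and a (sufficiently smooth) function $F$, $$G_{m,F}(n):=\sum_{j=1}^m\gamma_{m,j}\sum_{i=0}^{j-1}F(n-1+j/2-i),\qquad\gamma_{m,j}:=(-1)^{j-1}\,\frac2j\,\binom{2m}{m+j}\Big/\binom{2m}{m},$$ $$G^{\mathrm{EM}}_{m,F}(n):=F(n-1)+\frac{F'(n-1)}2+\sum_{j=1}^{m-1}\frac{B_{2j}}{(2j)!}F^{(2j)}(n-1),$$ where $B_{2j}$ are the Bernoulli numbers ($B_2=1/6$, etc.); the sum of an empty family is $0$. The generalized sums are $$\sum_{k\ge0}^{\mathrm{Alt}}f(k):=\lim_{n\to\infty}\Big(\sum_{k=0}^{n-1}f(k)-G_{m_0,F}(n)\Big),\qquad\sum_{k\ge0}^{\mathrm{EM}}f(k):=\lim_{n\to\infty}\Big(\sum_{k=0}^{n-1}f(k)-G^{\mathrm{EM}}_{m_0,F}(n)\Big),$$ with the same antiderivative $F$ of $f$ in both (under (a)–(d), both limits exist and are finite). *)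

(* Defs.v *)
From HB Require Import structures.
From mathcomp Require Import all_boot all_order all_algebra.
From mathcomp Require Import all_classical all_reals all_analysis.
From mathcomp Require Import ring.
Set Implicit Arguments.
Unset Strict Implicit.
Unset Printing Implicit Defensive.
Import Order.TTheory GRing.Theory Num.Theory.
Import numFieldNormedType.Exports.
Local Open Scope classical_set_scope.
Local Open Scope ring_scope.

(* [:: B_0; ...; B_(n-1)], built from
   \sum_(k <= n) 'C(n + 1, k) B_k = (n == 0), so that B_1 = - 1/2. *)
Fixpoint bernoulli_seq (R : numFieldType) (n : nat) : seq R :=
  if n is p.+1 then
    let s := bernoulli_seq R p in
    rcons s (((p == 0)%:R - \sum_(0 <= k < p) 'C(p.+1, k)%:R * s`_k) / p.+1%:R)
  else [::].

Definition bernoulli_number (R : numFieldType) (n : nat) : R :=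
  (bernoulli_seq R n.+1)`_n.

Lemma size_bernoulli_seq (R : numFieldType) n : size (bernoulli_seq R n) = n.
Proof. by elim: n => //= n IH; rewrite size_rcons IH. Qed.

Lemma nth_bernoulli_seq (R : numFieldType) n k :
  (k < n)%N -> (bernoulli_seq R n)`_k = bernoulli_number R k.
Proof.
elim: n => // n IH; rewrite ltnS leq_eqVlt => /orP[/eqP-> //|kn].
by rewrite /= nth_rcons size_bernoulli_seq kn IH.
Qed.

Lemma bernoulli_numberP (R : numFieldType) (n : nat) :
  \sum_(0 <= k < n.+1) 'C(n.+1, k)%:R * bernoulli_number R k = (n == 0)%:R.
Proof.
rewrite big_nat_recr//= {2}/bernoulli_number /= nth_rcons size_bernoulli_seq.
rewrite ltnn eqxx binSn mulrCA divff ?pnatr_eq0// mulr1 addrC.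
rewrite [X in _ - X](eq_big_nat _ _
  (F2 := fun k => 'C(n.+1, k)%:R * bernoulli_number R k)) ?subrK//.
by move=> k /andP[_ kn]; rewrite nth_bernoulli_seq.
Qed.

Lemma bernoulli_number2 (R : numFieldType) : bernoulli_number R 2 = 6%:R^-1.
Proof.
have h0 := bernoulli_numberP R 0; have h1 := bernoulli_numberP R 1.
have h2 := bernoulli_numberP R 2.
rewrite !big_nat_recr ?big_geq//= in h0 h1 h2.
rewrite ?bin0 ?bin1 (_ : 'C(3, 2) = 3)%N//= in h0 h1 h2.
move: h0; rewrite add0r mul1r => h0; rewrite h0 in h1 h2.
apply: (mulfI (_ : 6%:R != 0)); rewrite ?pnatr_eq0// divff ?pnatr_eq0//.
transitivity (2%:R * (0 + 1%:R * 1%:R + 3%:R * bernoulli_number R 1 +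
    3%:R * bernoulli_number R 2) -
  3%:R * (0 + 1%:R * 1%:R + 2%:R * bernoulli_number R 1) + 1); first by ring.
by rewrite h1 h2 !mulr0 subrr add0r.
Qed.

(* Absolute continuity on every compact interval, not uniformly on the line. *)
Definition locally_absolutely_continuous (R : realType) (g : R -> R) : Prop :=
  forall a b eps : R, 0 < eps -> exists2 delta : R, 0 < delta &
    forall (n : nat) (u v : 'I_n -> R),
      (forall i, [/\ a <= u i, u i <= v i & v i <= b]) ->
      trivIset setT (fun i => `]u i, v i[%classic) ->
      \sum_(i < n) (v i - u i) < delta ->
      \sum_(i < n) `|g (v i) - g (u i)| < eps.

Definition is_Radon_Nikodym_derivative (R : realType) (g h : R -> R) : Prop :=
  locally_integrable [set: R] h /\
  forall a b : R, a <= b ->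
    g b - g a = \int[@lebesgue_measure R]_(x in `[a, b]) h x.

(* The class C^(alpha -), for alpha >= 1. *)
Definition Cminus (R : realType) (alpha : nat) (f : R -> R) : Prop :=
  [/\ forall i, (i.+1 < alpha)%N -> forall x, derivable (derive1n i f) x 1,
      forall i, (i < alpha)%N -> continuous (derive1n i f) &
      locally_absolutely_continuous (derive1n alpha.-1 f)].

Definition antiderivative (R : realType) (F f : R -> R) : Prop :=
  forall x : R, is_derive x 1 F (f x).

Definition series_cvg_uniformly (R : realType) (A : set R) (u : nat -> R -> R) :=
  exists S : R -> R,
    {uniform A, (fun n w => \sum_(0 <= k < n) u k w) @ \oo --> S}.

Definition gamma_coef (R : realType) (m j : nat) : R :=
  (-1) ^+ j.-1 * (2%:R / j%:R) * ('C(m.*2, m + j)%:R / 'C(m.*2, m)%:R).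

Definition G_alt (R : realType) (m : nat) (F : R -> R) (n : nat) : R :=
  \sum_(1 <= j < m.+1) gamma_coef R m j *
    \sum_(0 <= i < j) F (n%:R - 1 + j%:R / 2%:R - i%:R).

Definition G_EM (R : realType) (m : nat) (F : R -> R) (n : nat) : R :=
  F (n%:R - 1) + derive1 F (n%:R - 1) / 2%:R +
  \sum_(1 <= j < m) bernoulli_number R j.*2 / (j.*2)`!%:R *
    derive1n j.*2 F (n%:R - 1).

Definition alt_partial (R : realType) (m0 : nat) (f F : R -> R) (n : nat) : R :=
  \sum_(0 <= k < n) f k%:R - G_alt m0 F n.

Definition EM_partial (R : realType) (m0 : nat) (f F : R -> R) (n : nat) : R :=
  \sum_(0 <= k < n) f k%:R - G_EM m0 F n.

Definition alt_sum (R : realType) (m0 : nat) (f F : R -> R) : R :=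
  limn (alt_partial m0 f F).

Definition EM_sum (R : realType) (m0 : nat) (f F : R -> R) : R :=
  limn (EM_partial m0 f F).

(* Main.v *)
Require Import Defs.
From HB Require Import structures.
From mathcomp Require Import all_boot all_order all_algebra.
From mathcomp Require Import all_classical all_reals all_analysis.
From mathcomp Require Import measurable_realfun ring lra zify.
Set Implicit Arguments.
Unset Strict Implicit.
Unset Printing Implicit Defensive.
Import Order.TTheory GRing.Theory Num.Theory.
Import numFieldNormedType.Exports.
Local Open Scope classical_set_scope.
Local Open Scope ring_scope.

(* With [y = n - 1], [G_alt m F n] is [\sum_j gamma_j \sum_(i < j) F (y + h)] at
   the nodes [h = j / 2 - i], and the moments [\sum_j gamma_j \sum_i h ^ r] for
   [r < 2 m] are the Bernoulli numbers (with [B_1 = 1 / 2]): this follows from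
   the vanishing of the [2 m]-th finite difference on polynomials of smaller
   degree.  Taylor expansion of [F] at [y] thus gives
   [G_alt m F n - G_EM m0 F n = O(sup |F^(2 m0)|)] near [y] whenever
   [m0 <= m], with equality of both sides on polynomials of degree less than
   [2 m0].  Under (a) this tends to [0], for [m0] as well as for [m], so it
   remains to see that [\sum_(k < n) f k - G_alt m F n] converges.  That is a
   series of values of a functional vanishing on polynomials of degree at most
   [2 m]; by (b) the [2 m]-th derivatives of its blocks
   [\sum_(p <= k < q) F (k + w)] are [eps]-Lipschitz in [w], so it is Cauchy. *)

(** * Finite differences and moments of the nodes *)

Lemma alternating_binomial_sumS (R : pzRingType) n (u : nat -> R) :
  \sum_(0 <= k < n.+2) (-1) ^+ k * 'C(n.+1, k)%:R * u k =
  \sum_(0 <= k < n.+1) (-1) ^+ k * 'C(n, k)%:R * (u k - u k.+1).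
Proof.
rewrite big_nat_recl//= [RHS](eq_bigr (fun k =>
   (-1) ^+ k * 'C(n, k)%:R * u k - (-1) ^+ k * 'C(n, k)%:R * u k.+1)); last first.
  by move=> k _; rewrite mulrBr.
rewrite sumrB.
under eq_bigr do rewrite binS natrD mulrDr mulrDl.
rewrite big_split/= addrA; congr (_ + _); last first.
  by rewrite -sumrN; apply: eq_bigr => k _; rewrite exprS mulN1r !mulNr.
rewrite [in RHS]big_nat_recl//= big_nat_recr//= (@bin_small n n.+1)// mulr0n mulr0 mul0r addr0.
by rewrite !bin0.
Qed.

(** Induction on the order: passing from [p] to [p - (p \Po ('X + 1%:P))] cancels the leading
    coefficient. *)
Lemma alternating_binomial_sum_poly (R : numDomainType) n (p : {poly R}) :
  (size p <= n)%N ->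
  \sum_(0 <= k < n.+1) (-1) ^+ k * 'C(n, k)%:R * p.[k%:R] = 0.
Proof.
elim: n p => [|n IH] p sp.
  have -> : p = 0 by apply/eqP; rewrite -size_poly_eq0 -leqn0.
  by rewrite big1// => k _; rewrite horner0 mulr0.
rewrite alternating_binomial_sumS.
have := IH (p - (p \Po ('X + 1%:P))); rewrite (_ : (size _ <= n)%N); last first.
  have s2 : size ('X + 1%:P : {poly R}) = 2%N by rewrite size_XaddC.
  apply/leq_sizeP => j nj; rewrite coefB.
  have [pj|pj] := ltnP j (size p); last first.
    by rewrite !nth_default ?subrr// size_comp_poly2.
  have -> : j = (size p).-1 by lia.
  rewrite -lead_coefE.
  suff -> : (p \Po ('X + 1%:P))`_(size p).-1 = lead_coef p by rewrite subrr.
  rewrite -(size_comp_poly2 p s2) -lead_coefE lead_coef_comp ?s2//.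
  by rewrite lead_coefXaddC expr1n mulr1.
move=> /(_ isT) e; rewrite -[RHS]e; apply: eq_bigr => k _.
by rewrite hornerD hornerN horner_comp !hornerE -natr1.
Qed.

(** For odd [r = s + 1], the factor [2 / j] absorbs one power of [j / 2], and the sum is, up to a
    factor, the part [k > m] of the [2 m]-th difference of [((k - m) / 2) ^+ s]. That difference
    vanishes and its summands are symmetric about [k = m], so the part is fixed by the central
    summand, nonzero only for [s = 0]. *)
Lemma gamma_coef_odd_moments (R : realType) m r : (0 < m)%N -> (r <= m.*2)%N ->
  \sum_(1 <= j < m.+1) gamma_coef R m j *
     ((j%:R / 2%:R) ^+ r - (- (j%:R / 2%:R)) ^+ r) = (r == 1)%:R.
Proof.
move=> m0 rm; have [ro|re] := boolP (odd r); last first.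
  rewrite big1 => [|j _]; first by case: r re {rm} => [|[]].
  by rewrite exprNn -signr_odd (negbTE re) expr0 mul1r subrr mulr0.
case: r ro rm => // s /= se sm; rewrite eqSS.
pose t k : R := (-1) ^+ k * 'C(m.*2, k)%:R * ((k%:R - m%:R) / 2%:R) ^+ s.
have t0 : \sum_(0 <= k < m.*2.+1) t k = 0.
  have := @alternating_binomial_sum_poly R m.*2 ((2%:R^-1 *: ('X - m%:R%:P)) ^+ s).
  rewrite exprZn (leq_trans (size_scale_leq _ _)) ?size_exp_XsubC// => /(_ isT) e.
  rewrite -[RHS]e; apply: eq_bigr => k _.
  by rewrite /t !hornerE exprMn [_ ^+ s * _ ^+ s]mulrC mulrA.
have C0 : 'C(m.*2, m)%:R != 0 :> R by rewrite pnatr_eq0 -lt0n bin_gt0; lia.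
have tm : t m = (-1) ^+ m * 'C(m.*2, m)%:R * (s == 0)%:R.
  by rewrite /t subrr mul0r expr0n.
(* The reflection of [k] to [2 m - k] preserves [t], because [s] is even. *)
have trev i : (i <= m)%N -> t (m - i)%N = t (m + i)%N.
  move=> im; rewrite /t -[in 'C(_, m + i)]bin_sub; last lia.
  rewrite (_ : m.*2 - (m + i) = m - i)%N; last lia.
  rewrite natrB// natrD (_ : (m%:R - i%:R - m%:R) = - (i%:R : R)); last by ring.
  rewrite (_ : (m%:R + i%:R - m%:R) = (i%:R : R)); last by ring.
  rewrite mulNr (exprNn (i%:R / 2%:R)) -[(-1) ^+ s]signr_odd (negbTE se) mul1r.
  rewrite -[(-1) ^+ (m - i)]signr_odd -[(-1) ^+ (m + i)]signr_odd.
  by rewrite oddB// oddD.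
have main : t m + 2%:R * \sum_(1 <= j < m.+1) t (m + j)%N = 0.
  have tail : \sum_(m.+1 <= k < m.*2.+1) t k = \sum_(1 <= j < m.+1) t (m + j)%N.
    rewrite -[in LHS](add1n m) big_addn (_ : m.*2.+1 - m = m.+1)%N; last lia.
    by apply: eq_bigr => j _; rewrite addnC.
  have head : \sum_(0 <= k < m) t k = \sum_(1 <= j < m.+1) t (m + j)%N.
    rewrite big_nat_rev/= big_add1 /=; apply: eq_big_nat => i /andP[_ im].
    by rewrite add0n trev.
  apply: etrans t0; rewrite [RHS](@big_cat_nat _ _ _ m)//=; last lia.
  rewrite [\sum_(m <= i < _) _]big_ltn; last lia.
  by rewrite tail head; ring.
have -> : (s == 0)%:R = - ((-1) ^+ m / 'C(m.*2, m)%:R *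
       (2%:R * \sum_(1 <= j < m.+1) t (m + j)%N)).
  move/eqP: main; rewrite addr_eq0 => /eqP; rewrite tm.
  move=> /(congr1 (fun x => (-1) ^+ m / 'C(m.*2, m)%:R * x)).
  rewrite mulrN => <-; have := sqrr_sign R m; rewrite expr2 => he.
  transitivity ((-1) ^+ m * (-1) ^+ m * (s == 0)%:R : R); first by rewrite he mul1r.
  by field.
rewrite !mulr_sumr -sumrN; apply: eq_big_nat => j /andP[j1 jm].
have j0 : j%:R != 0 :> R by rewrite pnatr_eq0 -lt0n.
rewrite /t natrD (_ : (m%:R + j%:R - m%:R) = (j%:R : R)); last by ring.
rewrite (exprNn (j%:R / 2%:R)) !exprS -[(-1) ^+ s]signr_odd (negbTE se) /gamma_coef.
rewrite exprD; case: j j1 jm j0 => // j _ jm j0 /=; rewrite [(-1) ^+ j.+1]exprS expr0.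
have := sqrr_sign R m; rewrite expr2; set e := (-1) ^+ m => he.
apply/eqP; rewrite -subr_eq0; apply/eqP.
(* The sides differ by a multiple of [1 - e * e], where [e] is a sign. *)
transitivity ((1 - e * e) * (2%:R * (-1) ^+ j * 'C(m.*2, m + j.+1)%:R *
  (j.+1%:R / 2%:R) ^+ s / 'C(m.*2, m)%:R : R)).
  by move: j0; rewrite -natr1 [_ + 1]addrC => j0; field; rewrite C0 j0.
by rewrite he subrr mul0r.
Qed.

(** This is [G_alt m F 1] for [F x = x ^+ r]. *)
Definition alt_moment (R : realType) (m r : nat) : R :=
  \sum_(1 <= j < m.+1) gamma_coef R m j *
    \sum_(0 <= i < j) (j%:R / 2%:R - i%:R) ^+ r.

Lemma telescope_nodes (V : zmodType) (F : nat -> V) j :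
  \sum_(0 <= i < j) (F i - F i.+1) = F 0%N - F j.
Proof.
rewrite -(opprK (_ - _)) opprB -(telescope_sumr F (leq0n j)) -sumrN.
by apply: eq_bigr => i _; rewrite opprB.
Qed.

(** In the binomial expansion only the term of first order in [j / 2] survives, so these symmetric
    differences differentiate polynomials of degree at most [2 m] exactly. *)
Lemma gamma_coef_derivative (R : realType) m (x : R) N :
  (0 < m)%N -> (N <= m.*2)%N ->
  \sum_(1 <= j < m.+1) gamma_coef R m j *
    ((x + j%:R / 2%:R) ^+ N - (x - j%:R / 2%:R) ^+ N) = x ^+ N.-1 *+ N.
Proof.
move=> m0 Nm.
transitivity (\sum_(i < N.+1) \sum_(1 <= j < m.+1) (x ^+ (N - i) *+ 'C(N, i)) *
   (gamma_coef R m j * ((j%:R / 2%:R) ^+ i - (- (j%:R / 2%:R)) ^+ i))).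
  rewrite exchange_big/=; apply: eq_bigr => j _.
  rewrite !exprDn -sumrB mulr_sumr; apply: eq_bigr => i _.
  by rewrite -mulrnBl -mulrBr [RHS]mulrnAl [LHS]mulrnAr mulrCA.
transitivity (\sum_(i < N.+1) (x ^+ (N - i) *+ 'C(N, i)) * (i == 1 :> nat)%:R).
  apply: eq_bigr => i _; rewrite -mulr_sumr gamma_coef_odd_moments//.
  by rewrite (leq_trans _ Nm)// -ltnS.
case: N {Nm} => [|N]; first by rewrite big_ord_recl big_ord0 /= mulr0 addr0 mulr0n.
rewrite !big_ord_recl/= big1 => [|i _]; last by rewrite mulr0.
by rewrite mulr0 add0r addr0 mulr1 subn1 bin1.
Qed.

(** Exact differentiation of [x ^+ N] at [x = 1], with each difference telescoped into terms
    [(1 + h) ^+ N - h ^+ N] over the nodes [h]. This is the Bernoulli recurrence for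
    [B_1 = 1 / 2]. *)
Lemma sum_alt_moment (R : realType) m N : (0 < m)%N -> (N <= m.*2)%N ->
  \sum_(0 <= k < N) 'C(N, k)%:R * alt_moment R m k = N%:R.
Proof.
move=> m0 Nm; have := @gamma_coef_derivative R m 1 N m0 Nm.
rewrite expr1n => <-; rewrite /alt_moment.
under eq_bigr do rewrite mulr_sumr.
rewrite exchange_big/=; apply: eq_bigr => j _.
under eq_bigr do rewrite mulrCA.
rewrite -mulr_sumr; congr (_ * _).
under eq_bigr do rewrite mulr_sumr.
rewrite exchange_big/=.
pose F i : R := (j%:R / 2%:R + 1 - i%:R) ^+ N.
rewrite (_ : (1 + _) ^+ _ = F 0%N); last by rewrite /F subr0 addrC.
rewrite (_ : (1 - _) ^+ _ = F j); last by rewrite /F; congr (_ ^+ _); field.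
rewrite -telescope_nodes; apply: eq_bigr => i _.
have -> : F i = (1 + (j%:R / 2%:R - i%:R)) ^+ N by rewrite /F; congr (_ ^+ _); ring.
have -> : F i.+1 = (j%:R / 2%:R - i%:R) ^+ N.
  by rewrite /F -natr1; congr (_ ^+ _); ring.
rewrite exprDn big_ord_recr/= subnn expr0 mul1r binn mulr1n addrK big_mkord.
by apply: eq_bigr => k _; rewrite expr1n mul1r; exact: mulr_natl.
Qed.

(* The reflection [i |-> j - 1 - i] maps the node [h] to [- (h - 1)], so twice
   an odd moment telescopes. *)
Lemma alt_moment_odd (R : realType) m r : (0 < m)%N -> (r <= m.*2)%N -> odd r ->
  alt_moment R m r = (r == 1)%:R / 2%:R.
Proof.
move=> m0 rm ro; rewrite -(gamma_coef_odd_moments R m0 rm) mulr_suml.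
apply: eq_bigr => j _; rewrite -[RHS]mulrA; congr (_ * _).
pose F i : R := (j%:R / 2%:R - i%:R) ^+ r.
have F0 : F 0%N = (j%:R / 2%:R) ^+ r by rewrite /F subr0.
have Fj : F j = (- (j%:R / 2%:R)) ^+ r by rewrite /F; congr (_ ^+ _); field.
rewrite -F0 -Fj -telescope_nodes sumrB.
suff -> : \sum_(0 <= i < j) F i.+1 = - \sum_(0 <= i < j) F i.
  by rewrite opprK -[LHS]/(\sum_(0 <= i < j) F i); field.
rewrite big_nat_rev/= -sumrN; apply: eq_big_nat => i /andP[_ ij].
rewrite /F add0n subnSK// natrB; last exact: ltnW.
rewrite (_ : _ - (_ - _) = - (j%:R / 2%:R - i%:R)); last by field.
by rewrite exprNn -signr_odd ro expr1 mulN1r.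
Qed.

(** Moments and Bernoulli numbers obey recurrences that differ only in the right-hand side; the top
    coefficient [r + 1] is nonzero, so each recurrence determines its next term. *)
Lemma alt_moment_bernoulli (R : realType) m r : (r < m.*2)%N ->
  alt_moment R m r = bernoulli_number R r + (r == 1)%:R.
Proof.
move=> rm; have m0 : (0 < m)%N by lia.
elim/ltn_ind: r rm => r IH rm.
have := sum_alt_moment R m0 rm; have := bernoulli_numberP R r.
rewrite !big_nat_recr//= binSn => hB hA.
have r0 : r.+1%:R != 0 :> R by rewrite pnatr_eq0.
apply: (mulfI r0); rewrite mulrDr (canRL (addKr _) hA) (canRL (addKr _) hB).
rewrite (@eq_big_nat _ _ _ _ _ (fun k => 'C(r.+1, k)%:R * alt_moment R m k)
  (fun k => 'C(r.+1, k)%:R * bernoulli_number R k + 'C(r.+1, k)%:R * (k == 1)%:R)); last first.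
  move=> i /andP[_ ir]; rewrite IH//; first by rewrite mulrDr.
  exact: ltn_trans rm.
rewrite big_split/=.
(* The index [k = 1] is in range only for [r >= 2]; the two subtracted terms correct [r = 0] and
   [r = 1]. *)
suff e : \sum_(0 <= k < r) 'C(r.+1, k)%:R * (k == 1)%:R =
    r.+1%:R - (r == 0)%:R - r.+1%:R * (r == 1)%:R :> R.
  by rewrite e; ring.
case: r {IH rm hA hB r0} => [|[|r]].
- by rewrite big_geq// subrr mulr0 subr0.
- by rewrite big_nat1 /= mulr0 mulr1 subr0 subrr.
- rewrite 2?big_nat_recl//= big1 => [|i _]; last by rewrite mulr0.
  by rewrite bin1 !mulr0 add0r addr0 mulr1 !subr0.
Qed.

(** The moment of order [r], taken with [m = r], is zero by reflection and equals the Bernoulli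
    number by the recurrence. *)
Lemma bernoulli_number_odd (R : realType) r : (1 < r)%N -> odd r ->
  bernoulli_number R r = 0.
Proof.
move=> r1 ro; have rr : (r < r.*2)%N by lia.
have := alt_moment_bernoulli R rr.
rewrite alt_moment_odd ?(ltnW rr)// ?gtn_eqF//; last lia.
by rewrite mul0r addr0.
Qed.

(* [c r] stands for the [r]-th derivative of [F] at [n - 1]. *)
Lemma sum_alt_moment_EM (R : realType) m m0 (c : nat -> R) :
  (0 < m0 <= m)%N ->
  \sum_(0 <= r < m0.*2) alt_moment R m r / r`!%:R * c r =
  c 0%N + c 1%N / 2%:R +
  \sum_(1 <= j < m0) bernoulli_number R j.*2 / (j.*2)`!%:R * c j.*2.
Proof.
elim: m0 => // m0 IH /andP[_ mm].
case: m0 IH mm => [_ m1|m0 IH mm].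
  rewrite [X in _ + X]big_geq// addr0 2?big_nat_recl// big_geq// addr0.
  rewrite (@alt_moment_odd _ _ 1)//; [|lia..].
  rewrite (@alt_moment_bernoulli _ _ 0); last lia.
  have := bernoulli_numberP R 0; rewrite big_nat1 bin0 mul1r => ->.
  by rewrite !factS !fact0 !divr1 !addr0 !mul1r mulrC.
(* Raising [m0] by one adds an even-order term, the next Euler-Maclaurin term, and an odd-order term
   that vanishes. *)
rewrite doubleS 2?big_nat_recr//= IH; last lia.
rewrite [in RHS]big_nat_recr//= -!addrA; do 3 congr (_ + _).
rewrite !alt_moment_bernoulli; [|lia..].
rewrite (@bernoulli_number_odd _ m0.+1.*2.+1)//; last by rewrite /= odd_double.
by rewrite !addr0 !mul0r addr0.
Qed.

(** * Translation of integrals and blocks of translates *)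

Lemma addr_preimage_itvbndbnd (R : realType) (c a b : R) (ba bb : bool) :
  (fun x => c + x) @^-1` [set` Interval (BSide ba (c + a)) (BSide bb (c + b))] =
  [set` Interval (BSide ba a) (BSide bb b)].
Proof.
by apply/seteqP; split => x /=;
  rewrite !in_itv/=; case: ba; case: bb; rewrite /= ?lerD2l ?ltrD2l.
Qed.

(** Lebesgue measure is determined by its values on intervals, and translation preserves their
    length. *)
Lemma lebesgue_measure_translation (R : realType) (c : R) (A : set R) :
  measurable A ->
  pushforward lebesgue_measure ((fun x => c + x) : _ -> measurableTypeR R) A =
  lebesgue_measure A.
Proof.
move=> mA; apply/esym/lebesgue_measure_unique => //=.
  exact: measurable_funD.
move=> mtr _ [[a b]] _ <-.
rewrite /pushforward -[a in RHS](subrK c) -[b in RHS](subrK c).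
rewrite ![_ - c + c]addrC addr_preimage_itvbndbnd !lebesgue_measure_itv/=.
by rewrite !lte_fin ltrD2r -!EFinD; case: ifP => // _; congr EFin; ring.
Qed.

Section translation.
Variables (R : realType) (c a b : R) (h : R -> R).
Hypothesis loc_h : locally_integrable [set: R] h.
Let mu := @lebesgue_measure R.
Let tr : measurableTypeR R -> measurableTypeR R := fun x => c + x.

Let mtr : measurable_fun [set: measurableTypeR R] tr.
Proof. exact: measurable_funD. Qed.

Let mh : measurable_fun [set: R] h.
Proof. by case: loc_h. Qed.

Lemma integrable_translation : mu.-integrable `[a, b] (EFin \o (h \o +%R c)).
Proof.
apply/integrableP; split.
  apply: measurable_funTS; apply/measurable_EFinP.
  exact: (measurableT_comp mh mtr).
have [_ _ /(_ `[c + a, c + b]%classic)] := loc_h.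
move=> /(_ (@subsetT _ _) (@segment_compact _ _ _)).
apply: le_lt_trans; rewrite -(addr_preimage_itvbndbnd c).
rewrite -(@ge0_integral_pushforward _ _ _ _ R tr mtr mu _ (fun x => `|h x|%:E))//=.
  rewrite (@eq_measure_integral _ _ _ _ (@lebesgue_measure R))// => A mA _.
  exact: lebesgue_measure_translation.
by apply: measurable_funTS; apply/measurable_EFinP; exact: measurableT_comp.
Qed.

Lemma Rintegral_translation :
  \int[mu]_(x in `[c + a, c + b]) h x = \int[mu]_(x in `[a, b]) h (c + x).
Proof.
congr fine; rewrite -[in RHS](addr_preimage_itvbndbnd c).
rewrite -(@integral_pushforward _ _ _ _ R tr mtr mu _ (fun x => (h x)%:E))//=.
- by apply: eq_measure_integral => A mA _; apply/esym; exact: lebesgue_measure_translation.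
- exact/measurable_EFinP.
- by rewrite addr_preimage_itvbndbnd; exact: integrable_translation.
Qed.

End translation.

Lemma Radon_Nikodym_translates_sum (R : realType) (g h : R -> R) (a b : R) p q :
  is_Radon_Nikodym_derivative g h -> a <= b ->
  (@lebesgue_measure R).-integrable `[a, b]
    (EFin \o fun w => \sum_(p <= k < q) h (k%:R + w)) /\
  \sum_(p <= k < q) (g (k%:R + b) - g (k%:R + a)) =
  \int[@lebesgue_measure R]_(w in `[a, b]) \sum_(p <= k < q) h (k%:R + w).
Proof.
move=> [lh gh] ab; elim: (index_iota p q) => [|k s [IHi IHe]].
  under [X in EFin \o X]eq_fun do rewrite big_nil.
  under eq_Rintegral do rewrite big_nil.
  by rewrite big_nil Rintegral_cst// mul0r; split => //; exact: integrable0.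
under [X in EFin \o X]eq_fun do rewrite big_cons.
under eq_Rintegral do rewrite big_cons.
have ik := @integrable_translation R k%:R a b h lh.
split; first exact: (integrableD _ ik IHi).
rewrite big_cons IHe gh ?lerD2l// Rintegral_translation//.
by rewrite -RintegralD.
Qed.

(** The block is summed under the integral before absolute values are taken, so a bound on the block
    suffices, as uniform convergence of the series provides. *)
Lemma Radon_Nikodym_translates_sum_le (R : realType) (g h : R -> R) (a b e : R) p q :
  is_Radon_Nikodym_derivative g h -> a <= b ->
  (forall w, a <= w <= b -> `|\sum_(p <= k < q) h (k%:R + w)| <= e) ->
  `|\sum_(p <= k < q) (g (k%:R + b) - g (k%:R + a))| <= e * (b - a).
Proof.
move=> gh ab he; have [ih ->] := @Radon_Nikodym_translates_sum R g h a b p q gh ab.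
apply: le_trans (le_normr_Rintegral _ ih) _ => //.
have -> : e * (b - a) = \int[@lebesgue_measure R]_(w in `[a, b]) e.
  rewrite Rintegral_cst//= lebesgue_measure_itv/= lte_fin.
  case: ltP => [//|ba]; have -> : b = a by apply/eqP; rewrite eq_le ba ab.
  by rewrite subrr.
apply: le_Rintegral => //=.
- exact: (integrable_abse ih).
- by apply: continuous_compact_integrable; [exact: segment_compact|move=> x; exact: cvg_cst].
Qed.

(** * Taylor expansion *)

Lemma derive_continuous (R : realType) (f df : R -> R) :
  (forall x : R, is_derive x 1 f (df x)) -> continuous f.
Proof.
move=> fdf x; apply/differentiable_continuous/derivable1_diffP.
by case: (fdf x).
Qed.

Lemma mean_value_bound (R : realType) (f df : R -> R) (c K h : R) :
  (forall x : R, is_derive x 1 f (df x)) ->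
  (forall x, `|x| <= c -> `|df x| <= K) ->
  `|h| <= c -> `|f h - f 0| <= K * c.
Proof.
move=> fdf dfK hc.
have cf := derive_continuous fdf.
have c0 : 0 <= c := le_trans (normr_ge0 _) hc.
have K0 : 0 <= K by apply: le_trans (normr_ge0 _) (dfK 0 _); rewrite normr0.
wlog : f df fdf dfK h hc cf / 0 <= h => [hwlog|h0].
  have [/hwlog|h0] := leP 0 h; first exact.
  have -> : f h - f 0 = (f \o -%R) (- h) - (f \o -%R) 0 by rewrite /= opprK oppr0.
  have gdf (x : R) : is_derive x 1 (f \o -%R) (- df (- x)).
    by rewrite -mulrN1; apply: is_derive1_comp.
  apply: (hwlog _ _ gdf); rewrite ?normrN ?oppr_ge0 ?(ltW h0)//.
  - by move=> x xc; rewrite normrN dfK// normrN.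
  - exact: (derive_continuous gdf).
have [z|z zh ->] := @MVT_segment R f df 0 h h0 (fun x _ => fdf x).
  exact: continuous_subspaceT.
move: zh; rewrite in_itv/= => /andP[z0 zh]; rewrite subr0 normrM.
apply: ler_pM => //; apply: dfK.
by rewrite ger0_norm// (le_trans zh)// (le_trans (ler_norm _)).
Qed.

(** Only the oscillation of the top derivative [g N] enters, since it need not be differentiable. By
    induction, the remainder vanishes at [0] and its derivative is the remainder of the shifted
    family; the mean value bound then costs one factor [c]. *)
Lemma taylor_bound (R : realType) N (g : nat -> R -> R) (y c M : R) :
  (forall r, (r < N)%N -> forall x : R, is_derive x 1 (g r) (g r.+1 x)) ->
  (forall t, `|t| <= c -> `|g N (y + t) - g N y| <= M) ->
  forall h, `|h| <= c ->
  `|g 0%N (y + h) - \sum_(0 <= r < N.+1) g r y / r`!%:R * h ^+ r| <= M * c ^+ N.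
Proof.
elim: N g => [|N IH] g dg gM h hc.
  by rewrite big_nat1 expr0 fact0 divr1 !mulr1 gM.
pose p := \poly_(r < N.+2) (g r y / r`!%:R).
pose q := \sum_(0 <= r < N.+1) g r.+1 y / r`!%:R *: 'X^r.
have pE t : p.[t] = \sum_(0 <= r < N.+2) g r y / r`!%:R * t ^+ r.
  by rewrite horner_poly big_mkord.
have p'E t : p^`().[t] = \sum_(0 <= r < N.+1) g r.+1 y / r`!%:R * t ^+ r.
  rewrite /p poly_def (linear_sum (@deriv R)) horner_sum big_ord_recl/= expr0 derivZ derivC.
  rewrite scaler0 horner0 add0r big_mkord; apply: eq_bigr => r _.
  rewrite /bump/= add1n derivZ derivXn/= !hornerE factS natrM.
  rewrite hornerMn hornerXn -[_ *+ r.+1]mulr_natl.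
  by field; rewrite nat1r !pnatr_eq0 -lt0n fact_gt0.
pose phi t := g 0%N (y + t) - p.[t].
pose dphi t := g 1%N (y + t) - p^`().[t].
have dphiP (t : R) : is_derive t 1 phi (dphi t).
  apply: is_deriveB; rewrite -[g 1%N _]mulr1.
  have -> : (fun t => g 0%N (y + t)) = g 0%N \o (shift y).
    by apply/funext => u /=; rewrite addrC.
  rewrite (addrC y t).
  exact: (@is_derive1_comp R (g 0%N) (shift y) t _ 1
    (dg 0%N isT (shift y t)) (is_derive_shift t 1 y)).
have dphi_le t : `|t| <= c -> `|dphi t| <= M * c ^+ N.
  by move=> tc; rewrite /dphi p'E; apply: (IH (fun r => g r.+1)) => // r rN; exact: dg.
have := mean_value_bound dphiP dphi_le hc.
rewrite {2}/phi pE addr0 big_nat_recl//= fact0 expr0 divr1 mulr1 big1 => [|i _].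
  by rewrite addr0 subrr subr0 /phi pE exprSr mulrA.
by rewrite exprS mul0r mulr0.
Qed.

(** * Comparison with the Euler-Maclaurin expression *)

(** By the moment formula, [G_EM m0] is [G_alt m] applied to the Taylor polynomial of degree less
    than [2 m0] at [n - 1], which leaves the Taylor remainder. *)
Lemma G_alt_sub_G_EM (R : realType) m0 m (F : R -> R) n : (0 < m0 <= m)%N ->
  G_alt m F n - G_EM m0 F n =
  \sum_(1 <= j < m.+1) gamma_coef R m j * \sum_(0 <= i < j)
    (F (n%:R - 1 + (j%:R / 2%:R - i%:R)) -
     \sum_(0 <= r < m0.*2) derive1n r F (n%:R - 1) / r`!%:R *
       (j%:R / 2%:R - i%:R) ^+ r).
Proof.
move=> m0m; pose y : R := n%:R - 1.
have -> : G_EM m0 F n =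
    \sum_(0 <= r < m0.*2) alt_moment R m r / r`!%:R * derive1n r F y.
  by rewrite sum_alt_moment_EM.
under [RHS]eq_bigr do rewrite sumrB mulrBr.
rewrite sumrB; congr (_ - _).
  by apply: eq_bigr => j _; congr (_ * _); apply: eq_bigr => i _; rewrite addrA.
under [RHS]eq_bigr do rewrite exchange_big/= mulr_sumr.
rewrite exchange_big/=; apply: eq_bigr => r _; rewrite -mulrA mulr_suml.
by apply: eq_bigr => j _; rewrite -mulr_sumr; ring.
Qed.

Lemma derive1n_horner (R : realType) (P : {poly R}) r :
  derive1n r (fun x => P.[x]) = (fun x => P^`(r).[x]).
Proof.
elim: r => [//|r IH]; rewrite derive1nS IH derivnS.
by apply/funext => x; rewrite derive1E; case: (is_derive_poly P^`(r) x).
Qed.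

Lemma G_alt_poly (R : realType) m0 m (P : {poly R}) n : (0 < m0 <= m)%N ->
  (size P <= m0.*2)%N -> G_alt m (fun x => P.[x]) n = G_EM m0 (fun x => P.[x]) n.
Proof.
move=> m0m sP; apply/eqP; rewrite -subr_eq0 G_alt_sub_G_EM//; apply/eqP.
rewrite big1// => j _; rewrite big1 ?mulr0// => i _.
rewrite (nderiv_taylor_wide _ sP); last exact: mulrC.
rewrite big_mkord -sumrB big1// => r _; rewrite derive1n_horner nderivn_def.
by rewrite hornerMn -(mulr_natr (P^`N(r).[_])) mulfK ?subrr// pnatr_eq0 -lt0n fact_gt0.
Qed.

Lemma cvg0_sum (R : realType) (I T : Type) (s : seq I) (Fi : set_system T)
    (FF : Filter Fi) (u : I -> T -> R) :
  (forall i, u i x @[x --> Fi] --> (0 : R)) ->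
  (\sum_(i <- s) u i x) @[x --> Fi] --> (0 : R).
Proof.
move=> u0; elim: s => [|i s IH].
  by under eq_cvg do rewrite big_nil; exact: cvg_cst.
under eq_cvg do rewrite big_cons.
by have := cvgD (u0 i) IH; rewrite addr0; apply.
Qed.

Lemma taylor_remainder_cvg0 (R : realType) N (F : R -> R) h :
  (forall r, (r < N)%N -> forall x : R,
     is_derive x 1 (derive1n r F) (derive1n r.+1 F x)) ->
  derive1n N F x @[x --> +oo] --> (0 : R) ->
  (F (y + h) - \sum_(0 <= r < N) derive1n r F y / r`!%:R * h ^+ r)
    @[y --> +oo] --> (0 : R).
Proof.
move=> dF FN0; pose c := `|h|.
have c0 : 0 <= c ^+ N by rewrite exprn_ge0 ?normr_ge0.
have C0 : 0 < 3 * (c ^+ N + 1) by lra.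
(* The constant [3] counts [2 d] for the oscillation of the [N]-th derivative and [d] for the Taylor
   term of order [N], absent from the sum; adding [1] keeps the divisor positive when [h = 0]. *)
apply/cvgr0Pnorm_lt => e e0; pose d := e / (3 * (c ^+ N + 1)).
have d0 : 0 < d by rewrite divr_gt0.
have dE : 3 * d * c ^+ N < e.
  have : d * (3 * (c ^+ N + 1)) = e by rewrite /d divfK// gt_eqF.
  by lra.
move/cvgr0Pnorm_lt : FN0 => /(_ d d0) [A [Ar Ad]].
(* Beyond [A + c], the whole ball of radius [c] about [y] lies beyond [A]. *)
exists (A + c); split; first by rewrite num_real.
move=> y Ay; apply: le_lt_trans dE.
have gd t : `|t| <= c -> `|derive1n N F (y + t)| <= d.
  by move=> tc; apply/ltW/Ad; move: tc; rewrite ler_norml => /andP[? _]; lra.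
have yd : `|derive1n N F y| <= d by rewrite -[y]addr0 gd// normr0 normr_ge0.
have := @taylor_bound R N (fun r => derive1n r F) y c (2 * d) dF _ h (lexx _).
rewrite big_nat_recr//= => /(_ _) tb.
have {}tb := tb (fun t tc => le_trans (ler_normB _ _)
  (eq_ind_r (fun z => _ <= z) (lerD (gd t tc) yd) (mulr_natl d 2))).
have last_le : `|derive1n N F y / N`!%:R * h ^+ N| <= d * c ^+ N.
  rewrite normrM normrX ler_wpM2r// normrM -[leRHS]mulr1 ler_pM//.
  by rewrite normfV normr_nat invf_le1 ?ler1n ?ltr0n fact_gt0.
move: tb last_le; rewrite opprD addrA => tb last_le.
rewrite -[X in `|X|](subrK (derive1n N F y / N`!%:R * h ^+ N)).
apply: le_trans (ler_normD _ _) _; lra.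
Qed.

Lemma cvg_natrB1 (R : realType) : (n%:R - 1 : R) @[n --> \oo] --> +oo.
Proof.
apply/cvgryPge => A; near=> n.
have : A + 1 <= n%:R by near: n; exact: nbhs_infty_ger.
by lra.
Unshelve. all: by end_near. Qed.

Lemma G_alt_sub_G_EM_cvg0 (R : realType) m0 m (F : R -> R) :
  (0 < m0 <= m)%N ->
  (forall r, (r < m0.*2)%N -> forall x : R,
     is_derive x 1 (derive1n r F) (derive1n r.+1 F x)) ->
  derive1n m0.*2 F x @[x --> +oo] --> (0 : R) ->
  G_alt m F n - G_EM m0 F n @[n --> \oo] --> (0 : R).
Proof.
move=> m0m dF F0; under eq_cvg do rewrite G_alt_sub_G_EM//.
apply: cvg0_sum => j.
have rem0 i := cvg_comp _ _ (@cvg_natrB1 R)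
  (@taylor_remainder_cvg0 R _ F (j%:R / 2%:R - i%:R) dF F0).
have := cvgM (cvg_cst (gamma_coef R m j)) (cvg0_sum (index_iota 0 j) _ rem0).
by rewrite mulr0; apply.
Qed.

(** * Convergence of the partial sums at order [m] *)

(** Increasing [n] by one shifts the unit-spaced nodes by one, so only the end nodes survive. *)
Lemma G_altB1 (R : realType) m (F : R -> R) k :
  G_alt m F k.+1 - G_alt m F k =
  \sum_(1 <= j < m.+1) gamma_coef R m j *
    (F (k%:R + j%:R / 2%:R) - F (k%:R - j%:R / 2%:R)).
Proof.
rewrite -sumrB; apply: eq_bigr => j _; rewrite -mulrBr; congr (_ * _).
pose u i : R := F (k%:R + j%:R / 2%:R - i%:R).
transitivity (u 0%N - u j); last by rewrite /u subr0; congr (_ - F _); field.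
rewrite -telescope_nodes -sumrB; apply: eq_bigr => i _.
by rewrite /u -!natr1; congr (F _ - F _); ring.
Qed.

(** The error at [k] of the symmetric difference formula for [F' = f]. *)
Definition alt_defect (R : realType) m (f F : R -> R) (k : nat) : R :=
  f k%:R - \sum_(1 <= j < m.+1) gamma_coef R m j *
    (F (k%:R + j%:R / 2%:R) - F (k%:R - j%:R / 2%:R)).

Lemma alt_partial_series (R : realType) m (f F : R -> R) :
  alt_partial m f F = fun n => series (alt_defect m f F) n - G_alt m F 0.
Proof.
apply/funext => n; rewrite /alt_partial /series/= /alt_defect sumrB.
under [X in _ = _ - X - _]eq_bigr do rewrite -G_altB1.
by rewrite telescope_sumr//; ring.
Qed.

(** The functional is applied to the block of translates of [F], and it kills the Taylor polynomial
    of degree [2 m] at [0]. What is left is the remainder at the two points [j / 2] and [- j / 2],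
    whence the factor [2]. *)
Lemma sum_alt_defect_le (R : realType) m (f f2m F : R -> R) p q e :
  (0 < m)%N ->
  (forall r, (r < m.*2)%N -> forall x : R,
     is_derive x 1 (derive1n r F) (derive1n r.+1 F x)) ->
  derive1 F = f ->
  is_Radon_Nikodym_derivative (derive1n m.*2 F) f2m ->
  (forall w, - (m%:R / 2%:R) <= w <= m%:R / 2%:R ->
     `|\sum_(p <= k < q) f2m (k%:R + w)| <= e) ->
  `|\sum_(p <= k < q) alt_defect m f F k| <=
  (\sum_(1 <= j < m.+1) `|gamma_coef R m j|) *
    (2 * (e * (m%:R / 2%:R) * (m%:R / 2%:R) ^+ m.*2)).
Proof.
move=> m0 dF Ff RN be; set c := m%:R / 2%:R.
have c0 : 0 <= c by rewrite divr_ge0.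
have e0 : 0 <= e.
  by apply: le_trans (normr_ge0 _) (be 0 _); rewrite -/c oppr_le0 c0.
pose g r w := \sum_(p <= k < q) derive1n r F (k%:R + w).
have dg r : (r < m.*2)%N -> forall x : R, is_derive x 1 (g r) (g r.+1 x).
  move=> rm x; rewrite /g; elim: (index_iota p q) => [|k s IH].
    under [X in is_derive _ _ X]eq_fun do rewrite big_nil.
    by rewrite big_nil; exact: is_derive_cst.
  under [X in is_derive _ _ X]eq_fun do rewrite big_cons.
  rewrite big_cons; apply: is_deriveD; rewrite -[X in is_derive _ _ _ X]mulr1.
  rewrite (_ : (fun w => _) = derive1n r F \o shift k%:R); last first.
    by apply/funext => w /=; rewrite addrC.
  rewrite addrC.
  exact: (@is_derive1_comp R (derive1n r F) (shift k%:R) x _ 1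
    (dF r rm (shift k%:R x)) (is_derive_shift x 1 k%:R)).
(* The block of [f2m] is the density of [g m.*2]; the sign of [t] decides the order of the
   endpoints. *)
have gM t : `|t| <= c -> `|g m.*2 (0 + t) - g m.*2 0| <= e * c.
  rewrite add0r ler_norml => /andP[ct tc]; rewrite /g -sumrB.
  have [t0|t0] := leP 0 t.
    apply: le_trans (@Radon_Nikodym_translates_sum_le R _ _ 0 t e p q RN t0 _) _.
      by move=> w /andP[w0 wt]; apply: be; rewrite -/c; lra.
    by rewrite subr0 ler_wpM2l.
  rewrite -normrN -sumrN; under eq_bigr do rewrite opprB.
  apply: le_trans (@Radon_Nikodym_translates_sum_le R _ _ t 0 e p q RN (ltW t0) _) _.
    by move=> w /andP[w0 wt]; apply: be; rewrite -/c; lra.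
  by rewrite sub0r ler_wpM2l// lerNl.
pose T h := \sum_(0 <= r < m.*2.+1) g r 0 / r`!%:R * h ^+ r.
have tb h : `|h| <= c -> `|g 0%N h - T h| <= e * c * c ^+ m.*2.
  by move=> hc; rewrite -[X in g _ X]add0r; exact: (taylor_bound dg gM hc).
(* [T] has degree at most [2 m], so its symmetric differences give exactly its derivative at [0]. *)
have TE : \sum_(1 <= j < m.+1) gamma_coef R m j *
    (T (j%:R / 2%:R) - T (- (j%:R / 2%:R))) = g 1%N 0.
  under eq_bigr do rewrite -sumrB mulr_sumr.
  rewrite exchange_big/=.
  transitivity (\sum_(0 <= r < m.*2.+1) g r 0 / r`!%:R * (r == 1)%:R).
    apply: eq_big_nat => r /andP[_ rm].
    rewrite -(gamma_coef_odd_moments R m0 (r := r))// mulr_sumr.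
    by apply: eq_bigr => j _; ring.
  have [k ->] : exists k, m.*2.+1 = k.+2 by exists m.*2.-1; lia.
  rewrite 2?big_nat_recl//=.
  rewrite big1 => [|i _]; last by rewrite mulr0.
  by rewrite mulr0 add0r addr0 mulr1 divr1.
have -> : \sum_(p <= k < q) alt_defect m f F k =
    \sum_(1 <= j < m.+1) gamma_coef R m j *
      ((g 0%N (- (j%:R / 2%:R)) - T (- (j%:R / 2%:R))) -
       (g 0%N (j%:R / 2%:R) - T (j%:R / 2%:R))).
  rewrite /alt_defect sumrB.
  have -> : \sum_(p <= k < q) f k%:R = g 1%N 0.
    by rewrite /g /= -Ff; apply: eq_bigr => k _; rewrite addr0.
  rewrite -TE exchange_big/= -sumrB; apply: eq_bigr => j _.
  by rewrite -mulr_sumr sumrB /g /=; ring.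
apply: le_trans (ler_norm_sum _ _ _) _; rewrite mulr_suml.
rewrite big_nat_cond [leRHS]big_nat_cond; apply: ler_sum => j /andP[/andP[_ jm] _].
have jc : `|j%:R / 2%:R : R| <= c.
  by rewrite ger0_norm ?divr_ge0// ler_wpM2r// ler_nat -ltnS.
rewrite normrM ler_wpM2l// (le_trans (ler_normB _ _))//.
have jcN : `|- (j%:R / 2%:R) : R| <= c by rewrite normrN.
by have := lerD (tb _ jcN) (tb _ jc); lra.
Qed.

Lemma series_cvg_uniformly_cauchy (R : realType) (A : set R) (u : nat -> R -> R) e :
  series_cvg_uniformly A u -> 0 < e ->
  exists N, forall p q, (N <= p)%N -> (N <= q)%N -> forall w, A w ->
    `|\sum_(p <= k < q) u k w| <= e.
Proof.
move=> [S uS] e0; have e2 : 0 < e / 2 by rewrite divr_gt0.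
have : nbhs (S : {uniform` A -> R})
    [set h | forall w, A w -> `|S w - h w| < e / 2].
  apply/uniform_nbhs; exists [set xy | `|xy.1 - xy.2| < e / 2]; split => //.
  by have := entourage_ball R (PosNum e2).
move=> /uS [N _ NS]; exists N => p q Np Nq w Aw.
have [qp|pq] := leqP q p; first by rewrite big_geq// normr0 ltW.
have := NS _ Np _ Aw; have := NS _ Nq _ Aw => /=.
rewrite (@big_cat_nat _ _ _ p)//=; last exact: ltnW.
rewrite !ltr_distl => /andP[? ?] /andP[? ?].
by rewrite ler_norml; lra.
Qed.

Lemma alt_partial_cvg (R : realType) m (f f2m F : R -> R) :
  (0 < m)%N ->
  (forall r, (r < m.*2)%N -> forall x : R,
     is_derive x 1 (derive1n r F) (derive1n r.+1 F x)) ->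
  derive1 F = f ->
  is_Radon_Nikodym_derivative (derive1n m.*2 F) f2m ->
  series_cvg_uniformly `[- (m%:R / 2%:R), m%:R / 2%:R]
    (fun k w => f2m (k%:R + w)) ->
  cvgn (alt_partial m f F).
Proof.
move=> m0 dF Ff RN uc; rewrite alt_partial_series.
apply: is_cvgB; last exact: is_cvg_cst.
apply/cauchy_cvgP/cauchy_seriesP => e e0.
set c : R := m%:R / 2%:R in uc.
have c0 : 0 <= c by rewrite divr_ge0.
pose K := (\sum_(1 <= j < m.+1) `|gamma_coef R m j|) * (2 * (c * c ^+ m.*2)).
have K0 : 0 <= K.
  by rewrite mulr_ge0 ?sumr_ge0// mulr_ge0// mulr_ge0// exprn_ge0.
(* The bound on the defects is linear in the bound on the blocks, with factor [K]; dividing by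
   [K + 1] makes the final inequality strict. *)
have d0 : 0 < e / (K + 1) by rewrite divr_gt0//; lra.
have [N Nuc] := series_cvg_uniformly_cauchy uc d0.
exists ([set n | (N <= n)%N], [set n | (N <= n)%N]); first by split; exists N.
move=> [p q] [/= Np Nq].
apply: le_lt_trans (sum_alt_defect_le m0 dF Ff RN
  (fun w wc => Nuc p q Np Nq w _)) _; first by [].
have : e / (K + 1) * (K + 1) = e by rewrite divfK// gt_eqF//; lra.
rewrite -/c => eK; rewrite [ltLHS](_ : _ = e / (K + 1) * K); last by rewrite /K; ring.
by rewrite -[ltRHS]eK; lra.
Qed.

Theorem proposition5p5 (R : realType) (m0 m : nat)
    (m0_gt0 : (0 < m0)%N) (m0_le_m : (m0 <= m)%N) :
  (forall f f2m : R -> R,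
     Cminus m.*2 f ->
     is_Radon_Nikodym_derivative (derive1n (m.*2).-1 f) f2m ->
     derive1n (m0.*2).-1 f x @[x --> +oo] --> (0 : R) ->
     series_cvg_uniformly `[- (m%:R / 2%:R), m%:R / 2%:R]
       (fun k w => f2m (k%:R + w)) ->
     (forall j : nat, (m0 <= j <= m.-1)%N ->
        derive1n (j.*2).-1 f x @[x --> +oo] --> (0 : R)) ->
     (\int[@lebesgue_measure R]_(x in `[0%R, +oo[)
        `|derive1n (m.*2).-1 f x|%:E < +oo)%E ->
     forall F : R -> R, antiderivative F f ->
     [/\ G_alt m0 F n - G_EM m0 F n @[n --> \oo] --> (0 : R),
         cvgn (alt_partial m0 f F),
         cvgn (EM_partial m0 f F) &
         alt_sum m0 f F = EM_sum m0 f F]) /\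
  (forall (P : {poly R}) (n : nat), (size P <= m0.*2)%N ->
     G_alt m (fun x => P.[x]) n = G_EM m (fun x => P.[x]) n).
Proof.
have m_gt0 := leq_trans m0_gt0 m0_le_m.
split=> [f f2m [fd _ _] RN a uc _ _ F FP|P n sP]; last first.
  apply: G_alt_poly; first by rewrite m_gt0 leqnn.
  by rewrite (leq_trans sP)// leq_double.
have Ff : derive1 F = f.
  by apply/funext => x; rewrite derive1E; case: (FP x).
have FS r : derive1n r.+1 F = derive1n r f by rewrite /derive1n iterSr Ff.
have dF r : (r < m.*2)%N -> forall x : R,
    is_derive x 1 (derive1n r F) (derive1n r.+1 F x).
  case: r => [|r] rm x; first by rewrite FS; exact: FP.
  by rewrite !FS derive1nS derive1E; apply/derivableP; exact: fd.
(* Odd derivatives of [f] become even derivatives of [F], the order at which the Taylor expansions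
   stop. *)
have F2 k : (0 < k)%N -> derive1n k.*2 F = derive1n k.*2.-1 f.
  by case: k => // k _; rewrite doubleS FS.
rewrite -F2// in RN; rewrite -F2// in a.
have G0 k : (m0 <= k)%N -> G_alt k F n - G_EM m0 F n @[n --> \oo] --> (0 : R).
  move=> m0k; apply: G_alt_sub_G_EM_cvg0 => //; first by rewrite m0_gt0.
  by move=> r rm; apply: dF; rewrite (leq_trans rm)// leq_double.
have Gm := G0 m m0_le_m; have Gm0 := G0 m0 (leqnn m0).
have /cvg_ex[l lP] := alt_partial_cvg m_gt0 dF Ff RN uc.
(* Convergence is known at order [m]; two null differences carry the limit [l] first to the
   Euler-Maclaurin sums at order [m0], then to the alternative sums at order [m0]. *)
have EMl : EM_partial m0 f F @ \oo --> l.
  have -> : EM_partial m0 f F =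
      alt_partial m f F + (fun n => G_alt m F n - G_EM m0 F n).
    by apply/funext => n; rewrite !fctE /alt_partial /EM_partial; ring.
  by rewrite -[l]addr0; exact: cvgD.
have altl : alt_partial m0 f F @ \oo --> l.
  have -> : alt_partial m0 f F =
      EM_partial m0 f F - (fun n => G_alt m0 F n - G_EM m0 F n).
    by apply/funext => n; rewrite !fctE /alt_partial /EM_partial; ring.
  by rewrite -[l]subr0; exact: (cvgB EMl Gm0).
split=> //; [by apply/cvg_ex; exists l|by apply/cvg_ex; exists l|].
by rewrite /alt_sum /EM_sum (cvg_lim _ altl)// (cvg_lim _ EMl).
Qed.
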